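(* Let $X=(X,\|\cdot\|)$ be a Banach space and let $(A_m)_{m\in\mathbb N}$ be a sequence of bounded linear operators on $X$ that admits a strong nonuniform polynomial dichotomy, and let $\epsilon\ge 0$ be the corresponding constant in the definition of this notion (the same $\epsilon$ in all three bounds). Then there exists $c_0>0$ such that for every $c\in(0,c_0]$ and every sequence $(B_m)_{m\in\mathbb N}$ of bounded linear operators on $X$ satisfying $$\|A_m-B_m\|\le\frac{c}{(m+1)^{2+\epsilon}}\quad\text{for all } m\in\mathbb N,$$ the sequence $(B_m)_{m\in\mathbb N}$ also admits a strong nonuniform polynomial dichotomy.
   Context: $\mathbb N=\{1,2,3,\dots\}$. Set $\mathcal A(m,n)=A_{m-1}\cdots A_n$ if $m>n$ and $\mathcal A(n,n)=\mathrm{Id}$ (and similarly for any other sequence of operators). Nonuniform polynomial dichotomy: $(A_m)_{m\in\mathbb N}$ admits a nonuniform polynomial dichotomy if (i) there exist projections $P_m$, $m\in\mathbb N$, on $X$ with $A_mP_m=P_{m+1}A_m$ for all $m\in\mathbb N$, such that each map $A_m|_{\operatorname{Ker}P_m}\colon\operatorname{Ker}P_m\to\operatorname{Ker}P_{m+1}$ is invertible; and (ii) there exist $\lambda,D>0$ and $\epsilon\ge0$ such that for $m,n\in\mathbb N$: $\|\mathcal A(m,n)P_n\|\le D(m/n)^{-\lambda}n^\epsilon$ for $m\ge n$, and $\|\mathcal A(m,n)Q_n\|\le D(n/m)^{-\lambda}n^\epsilon$ for $m\le n$, where $Q_n=\mathrm{Id}-P_n$ and, for $m<n$, $\mathcal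 A(m,n)=(\mathcal A(n,m)|_{\operatorname{Ker}P_m})^{-1}\colon\operatorname{Ker}P_n\to\operatorname{Ker}P_m$. Strong nonuniform polynomial dichotomy: $(A_m)_{m\in\mathbb N}$ admits a nonuniform polynomial dichotomy and, in addition, there exist $K,b>0$ and $\epsilon\ge0$ such that $\|\mathcal A(m,n)\|\le K(m/n)^bn^\epsilon$ for $m\ge n$. One can always take the same $\epsilon$ in all three bounds, and this is the convention used. *)

(* Defs.v *)
From HB Require Import structures.
From mathcomp Require Import all_boot all_order all_algebra.
From mathcomp Require Import all_classical all_reals all_analysis.
From mathcomp Require Import complex.
Import Order.TTheory GRing.Theory Num.Theory.
Import numFieldNormedType.Exports.

Set Implicit Arguments.
Unset Strict Implicit.
Unset Printing Implicit Defensive.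

Local Open Scope classical_set_scope.
Local Open Scope ring_scope.

(* The scalar field of a Banach space is R or R[i]. Both are covered by a
   [numFieldType] K whose subfield of real elements is identified with the real
   numbers R by an ordered embedding [iota]. The norm of a [normedModType K]
   takes its values in the nonnegative, hence real, elements of K. *)
Definition real_subfield (R : realType) (K : numFieldType)
    (iota : {rmorphism R -> K}) : Prop :=
  {mono iota : x y / x <= y} /\
  (forall z : K, z \is Num.real -> exists r : R, iota r = z).

Lemma real_subfield_real (R : realType) :
  @real_subfield R R (@idfun R : {rmorphism R -> R}).
Proof. by split=> [//|z _]; exists z. Qed.

Lemma real_subfield_complex (R : realType) :
  @real_subfield R R[i] (real_complex R).
Proof.
split=> [x y|z /complex_realP[r ->]]; first exact: lecR.
by exists r.
Qed.

Section dichotomy.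
Variables (R : realType) (K : numFieldType) (iota : {rmorphism R -> K}).
Variable X : normedModType K.

(* sup of |f x| over the closed unit ball, with value in \bar R so that it is
   +oo for an unbounded linear map *)
Definition opnorm (f : X -> X) : \bar R :=
  ereal_sup [set r%:E | r in
    [set r : R | exists2 x : X, `|x| <= 1 & `|f x| = iota r]].

Implicit Types (A P : nat -> {linear X -> X}) (m n : nat).

(* Sequences are indexed by the positive integers: the value at 0 of
   A : nat -> _ is never constrained nor used. *)

(* A_(m-1) o ... o A_n when n <= m *)
Definition evol A m n (x : X) : X := iteri (m - n) (fun k => A (n + k)%N) x.

Definition Ker P m : set X := [set x | P m x = 0].

(* For m <= n, the inverse Ker P_n -> Ker P_m of the restriction to Ker P_m of
   A_(n-1) o ... o A_m. *)
Definition evol_back A P m n : X -> X :=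
  'pinv_(fun=> 0) (Ker P m) (evol A n m).

(* Boundedness of the projections is not required separately: it is part of the
   dichotomy estimates below, with m = n. *)
Definition invariant_projections A P : Prop :=
  forall m, (0 < m)%N ->
  [/\ forall x, P m (P m x) = P m x,
      forall x, A m (P m x) = P m.+1 (A m x) &
      set_bij (Ker P m) (Ker P m.+1) (A m)].

Definition npdichotomy (eps : R) A : Prop :=
  exists2 P : nat -> {linear X -> X}, invariant_projections A P &
  exists lambda D : R,
  [/\ 0 < lambda, 0 < D, 0 <= eps,
      forall m n, (0 < n)%N -> (n <= m)%N ->
        (opnorm (fun x => evol A m n (P n x)) <=
         (D * (m%:R / n%:R) `^ (- lambda) * n%:R `^ eps)%:E)%E &
      forall m n, (0 < m)%N -> (m <= n)%N ->
        (opnorm (fun x => evol_back A P m n (x - P n x)%R) <=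
         (D * (n%:R / m%:R) `^ (- lambda) * n%:R `^ eps)%:E)%E].

Definition strong_npdichotomy (eps : R) A : Prop :=
  npdichotomy eps A /\
  exists L b : R,
  [/\ 0 < L, 0 < b &
      forall m n, (0 < n)%N -> (n <= m)%N ->
        (opnorm (evol A m n) <= (L * (m%:R / n%:R) `^ b * n%:R `^ eps)%:E)%E].

End dichotomy.

Lemma opnormP (R : realType) (K : numFieldType) (iota : {rmorphism R -> K})
    (h : real_subfield iota) (X : normedModType K) (f : {linear X -> X}) (M : R) :
  (opnorm iota f <= M%:E)%E <-> 0 <= M /\ forall x, `|f x| <= iota M * `|x|.
Proof.
case: h => mono sur.
have ex z : exists r, iota r = `|f z| by apply: sur; exact: normr_real.
split=> [le|[M0 le]].
  have le1 z : `|z| <= 1 -> `|f z| <= iota M.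
    move=> z1; have [r er] := ex z; rewrite -er mono -lee_fin.
    by apply: le_trans le; apply: ereal_sup_ubound; exists r => //; exists z.
  have M0 : 0 <= M by rewrite -mono rmorph0 -(normr0 X) -(linear0 f) le1// normr0.
  split=> // x; have [->|x0] := eqVneq x 0; first by rewrite linear0 !normr0 mulr0.
  have := le1 (`|x|^-1 *: x); rewrite linearZ !normrZ normfV normr_id.
  rewrite mulVf ?normr_eq0// => /(_ (lexx _)).
  by rewrite ler_pdivrMl ?normr_gt0// mulrC.
apply: ge_ereal_sup => _ [r [x x1 er] <-]; rewrite lee_fin -mono -er.
by rewrite (le_trans (le x))// ler_piMr// -(rmorph0 iota) mono.
Qed.

(* Main.v *)
Require Import Defs.
From HB Require Import structures.
From mathcomp Require Import all_boot all_order all_algebra.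
From mathcomp Require Import all_classical all_reals all_analysis.
From mathcomp Require Import ring lra.
Import Order.TTheory GRing.Theory Num.Theory.
Import numFieldNormedType.Exports.

Local Open Scope classical_set_scope.
Local Open Scope ring_scope.

(** A dichotomy of [A] is the same thing as a Green function
    [G m n = A(m,n) P_n] for [m >= n], [- A(m,n) Q_n] for [m < n], bounded by
    [D (max m n / min m n)^(-lam) n^eps]. It solves the recurrence
    [G (m+1) n = A_m G m n + [m+1 = n]], satisfies the adjoint identity
    [G m n = G m (n+1) A_n + [m = n]], and [G 1 1] is a projection that kills
    [G 1 n] for [n > 1]. Conversely these properties alone give back a dichotomy
    ([green_npdichotomy]): the projections are [G n n], the two identities
    make them invariant, and [- G m n] inverts the evolution on the unstable
    spaces.

    The Green function [H] of [B] is then the solution of the fixed point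
    equation [H m n = G m n + sum_k G m (k+1) (B_k - A_k) H k n]. The growth
    [(k+1)^eps] of [G m (k+1)] is cancelled by [|A_k - B_k|], which leaves the
    weights [c / (k+1)^2], of sum at most [c]. As the decay factors are
    submultiplicative up to the constant [exp lam], this equation is a
    contraction for the weighted sup norm as soon as [4 D c exp lam <= 1], and
    [H] is bounded by [2 D (max m n / min m n)^(-lam) n^eps], with the same
    [lam] and [eps]. The adjoint identity for [H] comes from uniqueness: its
    defect solves the homogeneous equation, hence vanishes. The boundary
    conditions at time [1] are inherited because [G 1 1 (G 1 (k+1) y) = 0]
    for every [k >= 1]. This is [perturbed_green_green].

    The growth bound on the evolution of [B] follows from the same summability
    by a discrete Gronwall inequality ([evol_growth]). *)

Set Implicit Arguments.
Unset Strict Implicit.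

(** * Polynomial decay and summable weights *)

Section decay.
Variable R : realType.
Implicit Types (a : R) (k m n : nat).

Lemma ln_nat_le m n : (0 < m)%N -> (m <= n)%N -> ln m%:R <= ln n%:R :> R.
Proof.
move=> m0 mn; rewrite ler_ln ?posrE ?ltr0n ?ler_nat//.
exact: leq_trans mn.
Qed.

Lemma powR_div_nat a m n : (0 < m)%N -> (0 < n)%N ->
  (m%:R / n%:R) `^ a = expR (a * (ln m%:R - ln n%:R)) :> R.
Proof.
move=> m0 n0; rewrite /powR mulf_eq0 invr_eq0 !pnatr_eq0 !gtn_eqF//=.
by rewrite ln_div// posrE ltr0n.
Qed.

(** The symmetric form [exp (- a |ln m - ln n|)] of [(max m n / min m n)^(-a)]
    covers both dichotomy estimates at once, and makes the multiplicativity
    below an instance of the triangle inequality. *)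
Definition decay a m n : R := expR (- (a * `|ln m%:R - ln n%:R|)).

Lemma decay_ge0 a m n : 0 <= decay a m n.
Proof. exact: expR_ge0. Qed.

Lemma decay_le1 a m n : 0 <= a -> decay a m n <= 1.
Proof. by move=> a0; rewrite -[leRHS]expR0 ler_expR oppr_le0 mulr_ge0. Qed.

Lemma decayxx a n : decay a n n = 1.
Proof. by rewrite /decay subrr normr0 mulr0 oppr0 expR0. Qed.

Lemma decay_powR a m n : (0 < n)%N -> (n <= m)%N ->
  decay a m n = (m%:R / n%:R) `^ (- a).
Proof.
move=> n0 nm; rewrite powR_div_nat ?(leq_trans n0)// /decay mulNr.
by rewrite ger0_norm// subr_ge0 ln_nat_le.
Qed.

Lemma decayC a m n : decay a m n = decay a n m.
Proof. by rewrite /decay distrC. Qed.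

Lemma decay_mul a m k n : 0 <= a ->
  decay a m k * decay a k n <= decay a m n.
Proof.
move=> a0; rewrite /decay -expRD ler_expR -opprD -mulrDr lerN2.
by rewrite ler_wpM2l// ler_distD.
Qed.

Lemma decayS a k : 0 <= a -> (0 < k)%N -> 1 <= expR a * decay a k.+1 k.
Proof.
move=> a0 k0; rewrite /decay -expRD -[leLHS]expR0 ler_expR subr_ge0.
rewrite -[leRHS]mulr1 ler_wpM2l// ger0_norm ?subr_ge0 ?ln_nat_le//.
have k0' : 0 < k%:R :> R by rewrite ltr0n.
have -> : ln k.+1%:R - ln k%:R = ln (1 + k%:R^-1) :> R.
  rewrite -ln_div ?posrE ?ltr0n//; congr ln.
  by rewrite -natr1 mulrDl mul1r divff// gt_eqF.
apply: le_trans (le_ln1Dx _) _; first by rewrite (lt_trans (ltrN10 _)) ?invr_gt0.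
by rewrite invf_le1// ler1n.
Qed.

(** Going from [k] to [k.+1] and back costs only a constant factor. *)
Lemma decay_mulS a m k n : 0 <= a -> (0 < k)%N ->
  decay a m k.+1 * decay a k n <= expR a * decay a m n.
Proof.
move=> a0 k0; have := decay_mul m k.+1 n a0; have := decay_mul k.+1 k n a0.
have := decayS a0 k0; have := expR_ge0 a.
move: (expR a) (decay_ge0 a m k.+1) (decay_ge0 a k n) (decay_ge0 a k.+1 n).
move: (decay a m k.+1) (decay a k.+1 k) (decay a k n) (decay a k.+1 n).
move: (decay a m n) => z x s y w e x0 y0 w0 e0 es syw xwz.
apply: le_trans (ler_wpM2l e0 xwz); rewrite mulrCA ler_wpM2l//.
apply: le_trans (ler_wpM2l e0 syw); rewrite mulrA.
by rewrite -[leLHS]mul1r ler_wpM2r.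
Qed.

(** The sum telescopes, since [1 / (k + 1)^2 <= 1 / k - 1 / (k + 1)]. *)
Lemma sum_inv_sqr q p : (q <= p)%N ->
  \sum_(q.+1 <= k < p.+1) (k.+1%:R ^+ 2)^-1 <= q.+1%:R^-1 - p.+1%:R^-1 :> R.
Proof.
elim: p => [|p IH]; first by rewrite leqn0 => /eqP->; rewrite big_geq// subrr.
rewrite leq_eqVlt => /orP[/eqP->|qp]; first by rewrite big_geq// subrr.
rewrite big_nat_recr//=; apply: le_trans (lerD (IH qp) (lexx _)) _.
rewrite -subr_ge0 -[p.+2%:R]natr1.
have p0 : 0 < p.+1%:R :> R by rewrite ltr0n.
set x := p.+1%:R in p0 *; set y := q.+1%:R^-1.
have -> : y - (x + 1)^-1 - (y - x^-1 + ((x + 1) ^+ 2)^-1) =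
   (x * (x + 1) ^+ 2)^-1.
  by field; lra.
by rewrite invr_ge0 mulr_ge0 ?exprn_ge0 ?ltW// ltr_wpDr.
Qed.

Lemma sum_inv_sqr_le1 q p : (0 < q)%N ->
  \sum_(q <= k < p) (k.+1%:R ^+ 2)^-1 <= 1 :> R.
Proof.
move=> q0; have [qp|qp] := ltnP q p; last by rewrite big_geq.
move: p q q0 qp => [|p] [|q] // _ qp.
apply: le_trans (sum_inv_sqr (@ltnW q p qp)) _.
rewrite lerBlDr (@le_trans _ _ 1) ?invf_le1 ?ler1n ?ltr0n//.
by rewrite lerDl invr_ge0.
Qed.

Lemma half_rate (S : R) q : 0 <= S -> 2^-1 * (S / q.+1%:R) <= S / q.+2%:R.
Proof.
move=> S0; rewrite mulrCA ler_wpM2l// -invfM lef_pV2 ?posrE ?mulr_gt0 ?ltr0n//.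
by rewrite -natrM ler_nat mul2n -addnn addSn ltnS ltn_addl.
Qed.

(** A perturbation of size [(k + 1)^(- (2 + eps))] absorbs the nonuniform factor
    [(k + 1)^eps] and leaves a summable weight. *)
Lemma powR_absorb (eps c : R) k :
  k.+1%:R `^ eps * (c / k.+1%:R `^ (2 + eps)) = c / k.+1%:R ^+ 2.
Proof.
have k0 : 0 < k.+1%:R :> R by rewrite ltr0n.
rewrite powRD; last by rewrite (gt_eqF k0) implybT.
rewrite powR_mulrn ?ltW//; field.
by rewrite !gt_eqF ?powR_gt0.
Qed.

Lemma powR_nat_ge1 (eps : R) n : 0 <= eps -> (0 < n)%N -> 1 <= n%:R `^ eps :> R.
Proof.
move=> e0 n0; rewrite -[leLHS](congr1 (@^~ eps) (@powR1 R)).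
by apply: ge0_ler_powR; rewrite ?nnegrE ?ler1n.
Qed.

End decay.

(** * Real-valued norms and limits *)

Section real_norm.
Variables (R : realType) (K : numFieldType) (iota : {rmorphism R -> K}).
Hypothesis iota_real : real_subfield iota.

Lemma iota_le x y : (iota x <= iota y) = (x <= y).
Proof. by case: iota_real. Qed.

Section normed.
Variable X : normedModType K.

(** The norm of [X] read in [R]; the default value is never reached, because
    norms are real elements of [K]. *)
Definition rnorm (x : X) : R := xget 0 [set r | iota r = `|x|].

Lemma iota_rnorm x : iota (rnorm x) = `|x|.
Proof.
have [r er] : exists r, iota r = `|x| by apply: iota_real.2; exact: normr_real.
by rewrite /rnorm; case: xgetP => [s _ ->//|/(_ r)].
Qed.

Lemma rnorm_ge0 x : 0 <= rnorm x.
Proof. by rewrite -iota_le rmorph0 iota_rnorm. Qed.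

Lemma rnorm_le0 x : rnorm x <= 0 -> x = 0.
Proof. by rewrite -iota_le rmorph0 iota_rnorm normr_le0 => /eqP. Qed.

Lemma rnorm0 : rnorm 0 = 0.
Proof.
by apply: le_anti; rewrite rnorm_ge0 andbT -iota_le iota_rnorm normr0 rmorph0.
Qed.

Lemma rnormN x : rnorm (- x) = rnorm x.
Proof. by rewrite /rnorm normrN. Qed.

Lemma rnormB x y : rnorm (x - y) = rnorm (y - x).
Proof. by rewrite -rnormN opprB. Qed.

Lemma rnormD x y : rnorm (x + y) <= rnorm x + rnorm y.
Proof. by rewrite -iota_le rmorphD !iota_rnorm ler_normD. Qed.

Lemma rnorm_sum (r : seq nat) (P : pred nat) (F : nat -> X) :
  rnorm (\sum_(i <- r | P i) F i) <= \sum_(i <- r | P i) rnorm (F i).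
Proof.
apply: (big_ind2 (fun x y => rnorm x <= y)) => [|x1 x2 y1 y2 h1 h2|//].
  by rewrite rnorm0.
by apply: le_trans (rnormD _ _) _; exact: lerD.
Qed.

Lemma rnormZ (a : K) : exists s : R, forall x, rnorm (a *: x) = s * rnorm x.
Proof.
have [s es] : exists r, iota r = `|a| by apply: iota_real.2; exact: normr_real.
exists s => x; apply: le_anti.
by rewrite -!iota_le rmorphM !iota_rnorm es normrZ lexx.
Qed.

Lemma opnorm_leP (f : X -> X) (M : R) : linear f ->
  (opnorm iota f <= M%:E)%E <-> 0 <= M /\ forall x, rnorm (f x) <= M * rnorm x.
Proof.
move=> lin_f.
pose g : {linear X -> X} := HB.pack f (GRing.isLinear.Build K X X *:%R f lin_f).
rewrite (opnormP iota_real g).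
by split=> -[M0 h]; split=> // x; have := h x;
  rewrite -iota_le rmorphM !iota_rnorm.
Qed.

Lemma linear_sub (f : X -> X) : linear f -> forall x y, f (x - y) = f x - f y.
Proof.
by move=> lin_f x y; rewrite addrC -scaleN1r lin_f scaleN1r addrC.
Qed.

Lemma linear_zero (f : X -> X) : linear f -> f 0 = 0.
Proof. by move=> /linear_sub/(_ 0 0); rewrite !subrr. Qed.

Lemma linear_opp (f : X -> X) : linear f -> forall x, f (- x) = - f x.
Proof.
by move=> lin_f x; rewrite -[- x]sub0r linear_sub// linear_zero// sub0r.
Qed.

(** Convergence with rate [1/q], the only mode of convergence needed; it makes
    passing to the limit in estimates a matter of elementary inequalities. *)
Definition tends (u : nat -> X) (l : X) : Prop :=
  exists E : R, forall q, rnorm (u q - l) <= E / q.+1%:R.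

Lemma le_vanishing (a b E : R) : (forall q, a <= b + E / q.+1%:R) -> a <= b.
Proof.
move=> h; apply/ler_addgt0Pr => e e0.
have [E0|E0] := leP E 0.
  apply: le_trans (h 0%N) _; rewrite lerD2l invr1 mulr1.
  exact: le_trans E0 (ltW e0).
have Ee : 0 < E / e by rewrite divr_gt0.
apply: le_trans (h (Num.truncn (E / e))) _; rewrite lerD2l ler_pdivrMr ?ltr0n//.
by rewrite mulrC -ler_pdivrMr// ltW// truncnS_gt.
Qed.

Lemma tends_rnorm_le u l C : tends u l -> (forall q, rnorm (u q) <= C) ->
  rnorm l <= C.
Proof.
move=> [E uE] uC; apply: (@le_vanishing _ _ E) => q.
rewrite -(subKr (u q) l); apply: le_trans (rnormD _ _) _.
by rewrite rnormN lerD.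
Qed.

Lemma tendsB u v l l' : tends u l -> tends v l' ->
  tends (fun q => u q - v q) (l - l').
Proof.
move=> [E uE] [F vF]; exists (E + F) => q.
rewrite opprD addrACA mulrDl -opprD; apply: le_trans (rnormD _ _) _.
by rewrite rnormN lerD.
Qed.

Lemma tendsZ (a : K) u l : tends u l -> tends (fun q => a *: u q) (a *: l).
Proof.
move=> [E uE]; have [s sP] := rnormZ a; exists (`|s| * E) => q.
rewrite -scalerBr sP -mulrA; apply: le_trans (ler_wpM2l (normr_ge0 _) (uE q)).
by rewrite ler_wpM2r ?rnorm_ge0// ler_norm.
Qed.

Lemma tends_cst l : tends (fun=> l) l.
Proof. by exists 0 => q; rewrite subrr rnorm0 mul0r. Qed.

Lemma tendsD u v l l' : tends u l -> tends v l' ->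
  tends (fun q => u q + v q) (l + l').
Proof.
move=> ul vl; have := tendsB ul (tendsB (tends_cst 0) vl).
by rewrite sub0r opprK; under eq_fun do rewrite sub0r opprK.
Qed.

Lemma tends_linear (f : X -> X) (M : R) u l : linear f ->
  (forall x, rnorm (f x) <= M * rnorm x) ->
  tends u l -> tends (fun q => f (u q)) (f l).
Proof.
move=> lin_f fM [E uE]; exists (`|M| * E) => q.
rewrite -linear_sub// -mulrA.
apply: le_trans (ler_wpM2l (normr_ge0 _) (uE q)).
by apply: le_trans (fM _) _; rewrite ler_wpM2r ?rnorm_ge0// ler_norm.
Qed.

Lemma tendsS u l : tends u l -> tends (fun q => u q.+1) l.
Proof.
move=> [E uE]; exists `|E| => q; apply: le_trans (uE _) _.
apply: (@le_trans _ _ (`|E| / q.+2%:R)).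
  by rewrite ler_wpM2r ?invr_ge0// ler_norm.
by rewrite ler_wpM2l// lef_pV2 ?posrE ?ltr0n// ler_nat.
Qed.

(** It is enough to know a sequence from some rank on, at the cost of a larger
    constant. *)
Lemma tends_eventually u v l q0 : tends u l ->
  (forall q, (q0 <= q)%N -> v q = u q) -> tends v l.
Proof.
move=> [E uE] uv.
pose S := \sum_(0 <= i < q0) rnorm (v i - l); exists (`|E| + S * q0.+1%:R) => q.
have S0 : 0 <= S by apply: sumr_ge0 => i _; exact: rnorm_ge0.
have [qq|qq] := leqP q0 q.
  rewrite uv//; apply: le_trans (uE q) _; rewrite ler_wpM2r ?invr_ge0//.
  by rewrite (le_trans (ler_norm _))// lerDl mulr_ge0.
rewrite ler_pdivlMr ?ltr0n//.
apply: (@le_trans _ _ (S * q0.+1%:R)); last by rewrite lerDr.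
apply: ler_pM; rewrite ?rnorm_ge0// ?ler_nat ?ltnS 1?ltnW//.
rewrite /S (bigD1_seq q) ?mem_index_iota ?iota_uniq//= lerDl.
by apply: sumr_ge0 => i _; exact: rnorm_ge0.
Qed.

Lemma tends_unique u l l' : tends u l -> tends u l' -> l = l'.
Proof.
move=> ul ul'; apply/eqP; rewrite -subr_eq0; apply/eqP/rnorm_le0.
by apply: (tends_rnorm_le (tendsB ul ul')) => q; rewrite subrr rnorm0.
Qed.

End normed.

Lemma tends_cauchy (X : completeNormedModType K) (u : nat -> X) (E : R) :
  (forall p q, (q <= p)%N -> rnorm (u p - u q) <= E / q.+1%:R) ->
  exists l, tends u l.
Proof.
move=> uE.
have iota0 (r : R) : (0 < iota r) = (0 < r) by rewrite !lt_def fmorph_eq0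
  -[X in X <= iota r](rmorph0 iota) iota_le.
have E0 : 0 <= E.
  by have := uE 0%N 0%N isT; rewrite invr1 mulr1; apply: le_trans (rnorm_ge0 _).
have rate (e : K) : 0 < e -> exists q, forall p, (q <= p)%N -> `|u p - u q| < e.
  move=> e0; have [r er] := iota_real.2 _ (gtr0_real e0).
  move: e0; rewrite -er iota0 => r0.
  exists (Num.truncn (E / r)) => p qp.
  rewrite -iota_rnorm -subr_gt0 -rmorphB iota0 subr_gt0.
  apply: le_lt_trans (uE _ _ qp) _.
  by rewrite ltr_pdivrMr ?ltr0n// mulrC -ltr_pdivrMr// truncnS_gt.
have /cauchy_cvgP cu : cauchy (u @ \oo).
  apply: cauchy_exP => e /rate[q uq]; exists (u q); exists q => // p /= qp.
  by rewrite -ball_normE/= distrC uq.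
exists (lim (u @ \oo)), E => q.
apply/ler_addgt0Pr => d d0.
have /cvgrPdist_lt /(_ (iota d)) := cu; rewrite iota0 => /(_ d0)[p0 _ up].
pose p := maxn p0 q.
have pd : rnorm (u p - lim (u @ \oo)) <= d.
  have /ltW := up p (leq_maxl _ _).
  by rewrite -iota_rnorm iota_le rnormB.
have -> : u q - lim (u @ \oo) = (u p - lim (u @ \oo)) - (u p - u q).
  by rewrite opprB [RHS]addrC subrKA.
apply: le_trans (rnormD _ _) _; rewrite addrC rnormN lerD//.
exact/uE/leq_maxr.
Qed.

End real_norm.

(** * Green functions and dichotomies *)

Section evolution.
Variables (K : numFieldType) (X : normedModType K).
Implicit Types (A P : nat -> {linear X -> X}) (m n : nat).

Lemma evolxx A n x : evol A n n x = x.
Proof. by rewrite /evol subnn. Qed.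

Lemma evolS A m n x : (n <= m)%N -> evol A m.+1 n x = A m (evol A m n x).
Proof. by move=> nm; rewrite /evol subSn//= subnKC. Qed.

Lemma evolSn A m n x : (n < m)%N -> evol A m n x = evol A m n.+1 (A n x).
Proof.
elim: m => // m IH; rewrite ltnS leq_eqVlt => /orP[/eqP->|nm].
  by rewrite evolS// !evolxx.
by rewrite evolS ?(ltnW nm)// IH// -evolS.
Qed.

Lemma evol_linear A m n : linear (evol A m n).
Proof.
rewrite /evol => a x y; elim: (m - n)%N => //= k ->.
by rewrite linearP.
Qed.

Section projections.
Variables A P : nat -> {linear X -> X}.
Hypothesis invP : invariant_projections A P.

Lemma proj_idem m x : (0 < m)%N -> P m (P m x) = P m x.
Proof. by move=> /invP[]. Qed.

Lemma proj_comm m x : (0 < m)%N -> A m (P m x) = P m.+1 (A m x).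
Proof. by move=> /invP[]. Qed.

Lemma proj_compl_Ker m x : (0 < m)%N -> P m (x - P m x) = 0.
Proof. by move=> m0; rewrite linearB/= proj_idem// subrr. Qed.

Lemma proj_comm_compl m x : (0 < m)%N ->
  A m (x - P m x) = A m x - P m.+1 (A m x).
Proof. by move=> m0; rewrite linearB/= proj_comm. Qed.

Lemma evol_Ker_bij m n : (0 < n)%N -> (n <= m)%N ->
  set_bij (Ker P n) (Ker P m) (evol A m n).
Proof.
move=> n0; elim: m => [|m IH]; first by rewrite leqNgt n0.
rewrite leq_eqVlt => /orP[/eqP<-|nm].
  split=> [x Px|x y _ _|x Px]; rewrite ?evolxx//.
  by exists x; rewrite ?evolxx.
have [_ _ [h1 h2 h3]] := invP (leq_trans n0 (nm : (n <= m)%N)).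
have [g1 g2 g3] := IH nm.
split=> [x Px|x y Px Py|z /h3[y Py <-]].
- by rewrite /= evolS//; apply/h1/g1.
- rewrite !evolS// => /h2 e; apply: g2 => //; apply: e; rewrite inE.
    exact/g1/set_mem.
  exact/g1/set_mem.
- by have [x Px <-] := g3 _ Py; exists x => //; rewrite evolS.
Qed.

Lemma evol_backP m n z : (0 < m)%N -> (m <= n)%N -> P n z = 0 ->
  P m (evol_back A P m n z) = 0 /\ evol A n m (evol_back A P m n z) = z.
Proof.
move=> m0 mn Pz; have [g1 g2 g3] := evol_Ker_bij m0 mn.
have [x Px <-] := g3 _ Pz.
by rewrite /evol_back pinvKV// ?inE.
Qed.

Lemma evol_backK m n x : (0 < m)%N -> (m <= n)%N -> P m x = 0 ->
  evol_back A P m n (evol A n m x) = x.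
Proof.
move=> m0 mn Px; have [g1 g2 g3] := evol_Ker_bij m0 mn.
by rewrite /evol_back pinvKV// inE.
Qed.

End projections.
End evolution.

Section green.
Variables (R : realType) (K : numFieldType) (iota : {rmorphism R -> K}).
Hypothesis iota_real : real_subfield iota.
Variable X : normedModType K.
Implicit Types (A P : nat -> {linear X -> X}) (G : nat -> nat -> X -> X).
Implicit Types (m n : nat) (x : X) (lam D eps c : R).

Local Notation N := (@rnorm R K iota X).

(** [G m n] is the response at time [m] of the system [u (m+1) = A m (u m)] to a
    unit impulse at time [n]. All these properties survive the perturbation of
    [A], the last one with a larger [D]. The boundary conditions at time [1] say
    that [G 1 1] is a projection whose kernel contains the values at time
    [1] of all the later responses. *)
Record green A G lam D eps : Prop := Green {
  green_linear : forall m n, (0 < m)%N -> (0 < n)%N -> linear (G m n);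
  green_rec : forall m n x, (0 < m)%N -> (0 < n)%N ->
    G m.+1 n x = A m (G m n x) + x *+ (m.+1 == n);
  green_corec : forall m n x, (0 < m)%N -> (0 < n)%N ->
    G m n x = G m n.+1 (A n x) + x *+ (m == n);
  green_proj1 : forall x, G 1 1 (G 1 1 x) = G 1 1 x;
  green_bdry : forall n x, (1 < n)%N -> G 1 1 (G 1 n x) = 0;
  green_bound : forall m n x, (0 < m)%N -> (0 < n)%N ->
    N (G m n x) <= D * decay lam m n * n%:R `^ eps * N x }.

(** ** From a dichotomy to its Green function *)

Definition dich_green A P m n x : X :=
  if (n <= m)%N then evol A m n (P n x) else - evol_back A P m n (x - P n x).

(** On the unstable side every identity follows from the uniqueness of a preimage
    in [Ker P m] under the evolution from [m] to [n]. *)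
Lemma dich_green_green A P lam D eps : invariant_projections A P ->
  (forall m n, (0 < n)%N -> (n <= m)%N ->
     (opnorm iota (fun x => evol A m n (P n x)) <=
      (D * (m%:R / n%:R) `^ (- lam) * n%:R `^ eps)%:E)%E) ->
  (forall m n, (0 < m)%N -> (m <= n)%N ->
     (opnorm iota (fun x => evol_back A P m n (x - P n x)%R) <=
      (D * (n%:R / m%:R) `^ (- lam) * n%:R `^ eps)%:E)%E) ->
  green A (dich_green A P) lam D eps.
Proof.
move=> invP fwd bwd.
have back_lin m n : (0 < m)%N -> (m <= n)%N ->
    linear (fun x => evol_back A P m n (x - P n x)).
  move=> m0 mn a x y; have n0 := leq_trans m0 mn.
  have bP z := evol_backP invP m0 mn (proj_compl_Ker invP z n0).
  have [Px ex] := bP x; have [Py ey] := bP y.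
  set bx := evol_back _ _ _ _ (x - _) in Px ex *.
  set by_ := evol_back _ _ _ _ (y - _) in Py ey *.
  rewrite -[RHS](evol_backK invP m0 mn); last by rewrite linearP/= Px Py scaler0 addr0.
  congr evol_back; rewrite evol_linear ex ey linearP/=.
  by rewrite scalerBr opprD addrACA.
have lin m n : (0 < m)%N -> (0 < n)%N -> linear (dich_green A P m n).
  move=> m0 n0 a x y; rewrite /dich_green; case: leqP => [nm|mn].
    by rewrite linearP/= evol_linear.
  by rewrite (back_lin _ _ m0 (ltnW mn)) opprD scalerN.
have P1G n x : (0 < n)%N -> P 1%N (dich_green A P 1 n x) = P 1%N x *+ (n == 1)%N.
  move=> n0; rewrite /dich_green; have [n1|n1] := leqP n 1.
    have -> : n = 1%N by apply/eqP; rewrite eqn_leq n1.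
    by rewrite evolxx (proj_idem invP).
  rewrite linearN/=; have [-> _] := evol_backP invP (ltn0Sn 0) (ltnW n1)
    (proj_compl_Ker invP x n0).
  by rewrite oppr0 gtn_eqF.
have G11 x : dich_green A P 1 1 x = P 1%N x by rewrite /dich_green leqnn evolxx.
split=> //.
- move=> m n x m0 n0; rewrite /dich_green.
  have [nm|mn|mn] := ltngtP n m.+1.
  + by rewrite -ltnS nm evolS// mulr0n addr0.
  + rewrite leqNgt (ltnW mn)/= mulr0n addr0 linearN/=; congr (- _).
    have m_n := ltnW (ltnW mn).
    have Pq := proj_compl_Ker invP x n0.
    have [Pb eb] := evol_backP invP m0 m_n Pq.
    rewrite -{1}eb evolSn//; last exact: ltnW.
    rewrite (evol_backK invP)//; first exact: ltnW.
    by rewrite -(proj_comm invP)// Pb linear0.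
  + rewrite {n}mn in n0 *; rewrite ltnn evolxx mulr1n.
    have [Pb eb] := evol_backP invP m0 (leqnSn m) (proj_compl_Ker invP x n0).
    move: eb; rewrite evolS// evolxx => eb.
    by rewrite linearN/= eb opprB subrK.
- move=> m n x m0 n0; rewrite /dich_green.
  have [nm|mn|mn] := ltngtP n m.
  + by rewrite evolSn// (proj_comm invP)// mulr0n addr0.
  + rewrite mulr0n addr0; congr (- _).
    rewrite -(proj_comm_compl invP)//.
    have [Pb eb] := evol_backP invP m0 (ltnW mn) (proj_compl_Ker invP x n0).
    rewrite -{2}eb -evolS ?(ltnW mn)// (evol_backK invP)//.
    exact/ltnW/ltnW.
  + rewrite {n0}mn mulr1n evolxx -(proj_comm_compl invP)//.
    rewrite -[A m _](evolxx A m.+1) -evolSn// (evol_backK invP)//.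
      by rewrite opprB subrK.
    exact: (proj_compl_Ker invP).
- by move=> x; rewrite !G11 (proj_idem invP).
- by move=> n x n1; rewrite G11 P1G ?gtn_eqF// ltnW.
- move=> m n x m0 n0; rewrite /dich_green; have [nm|mn] := leqP n m.
    have linf : linear (fun x => evol A m n (P n x)).
      by move=> a u v; rewrite linearP/= evol_linear.
    rewrite decay_powR//; have /(opnorm_leP iota_real _ linf)[_] := fwd m n n0 nm.
    exact.
  rewrite decayC decay_powR// ?(ltnW mn)// rnormN//.
  have := bwd m n m0 (ltnW mn).
  by move=> /(opnorm_leP iota_real _ (back_lin _ _ m0 (ltnW mn)))[_]; exact.
Qed.

(** ** From a Green function to a dichotomy *)

Section green_dichotomy.
Variables (A : nat -> {linear X -> X}) (G : nat -> nat -> X -> X).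
Variables lam D eps : R.
Hypothesis gG : green A G lam D eps.

Lemma green_evol m n p x : (0 < n)%N -> (n <= m)%N -> (0 < p)%N ->
  (m < p)%N || (p <= n)%N -> G m p x = evol A m n (G n p x).
Proof.
move=> n0 nm p0; elim: m nm => [|m IH]; first by rewrite leqNgt n0.
rewrite leq_eqVlt => /orP[/eqP<-|nm] mp; first by rewrite evolxx.
have m0 := leq_trans n0 (nm : (n <= m)%N).
rewrite evolS// (green_rec gG)// IH//.
  have -> : (m.+1 == p) = false.
    by case/orP: mp => [/ltn_eqF//|pn]; rewrite gtn_eqF// (leq_ltn_trans pn).
  by rewrite mulr0n addr0.
by case/orP: mp => [mp|->]; rewrite ?orbT// (ltnW mp).
Qed.

(** Both sides equal [A m x + A m (G m m.+1 (A m x))], by the adjoint identity on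
    the left and the recurrence on the right. *)
Lemma green_comm m x : (0 < m)%N -> A m (G m m x) = G m.+1 m.+1 (A m x).
Proof.
move=> m0; rewrite (green_corec gG x m0 m0) eqxx mulr1n linearD/=.
by rewrite [RHS](green_rec gG)// eqxx mulr1n.
Qed.

Lemma green_proj_evol m x : (0 < m)%N ->
  G m m (evol A m 1 x) = evol A m 1 (G 1 1 x).
Proof.
case: m => // m _; elim: m => [|m IH]; first by rewrite !evolxx.
by rewrite evolS// -green_comm// IH -evolS.
Qed.

(** A response that has not started yet lies in the unstable space. The identity
    is transported from time [1], where it is a boundary condition. *)
Lemma green_proj_early m n x : (0 < m)%N -> (m < n)%N -> G m m (G m n x) = 0.
Proof.
move=> m0 mn; rewrite (green_evol x (ltn0Sn 0) m0) ?mn ?(ltn_trans m0 mn)//.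
rewrite green_proj_evol// (green_bdry gG) ?(leq_ltn_trans m0)//.
exact/linear_zero/evol_linear.
Qed.

Lemma green_proj n x : (0 < n)%N -> G n n (G n n x) = G n n x.
Proof.
case: n => // -[|n] _; first exact: green_proj1 gG x.
have lin := green_linear gG (ltn0Sn n.+1) (ltn0Sn n.+1).
(* The complementary projection is [- A n.+1 (G n.+1 n.+2 x)], which invariance
   moves back to an early response. *)
have e : G n.+2 n.+2 x = A n.+1 (G n.+1 n.+2 x) + x.
  by rewrite (green_rec gG)// eqxx.
have := lin 1 (A n.+1 (G n.+1 n.+2 x)) x; rewrite !scale1r -e => ->.
by rewrite -green_comm// green_proj_early// linear0 add0r.
Qed.

(** The inverse of [A n] between the unstable spaces is [- G n n.+1]. *)
Lemma green_Ker_bij n : (0 < n)%N ->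
  set_bij [set x | G n n x = 0] [set x | G n.+1 n.+1 x = 0] (A n).
Proof.
move=> n0; split=> [x /= Gx|x y /set_mem/= Gx /set_mem/= Gy Axy|y /= Gy].
- by rewrite -green_comm// Gx linear0.
- have inv z : G n n z = 0 -> z = - G n n.+1 (A n z).
    move=> Gz; have := green_corec gG z n0 n0; rewrite Gz eqxx mulr1n.
    by move=> /esym/eqP; rewrite addrC addr_eq0 => /eqP.
  by rewrite (inv x Gx) (inv y Gy) Axy.
exists (- G n n.+1 y) => /=.
  by rewrite (linear_opp (green_linear gG n0 n0)) green_proj_early// oppr0.
have := green_rec gG y n0 (ltn0Sn n); rewrite Gy eqxx mulr1n => /esym/eqP.
by rewrite addrC addr_eq0 linearN => /eqP.
Qed.

Lemma green_evol_early m n x : (0 < m)%N -> (m < n)%N ->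
  evol A n m (G m n x) = G n n x - x.
Proof.
case: n => // n m0; rewrite ltnS => mn.
rewrite evolS// -green_evol// ?ltnSn// (green_rec gG) ?eqxx ?addrK//.
exact: leq_trans mn.
Qed.

Lemma green_npdichotomy : 0 < lam -> 0 < D -> 0 <= eps -> npdichotomy iota eps A.
Proof.
move=> lam0 D0 eps0.
have [P PE] : exists P : nat -> {linear X -> X},
    forall n x, (0 < n)%N -> P n x = G n n x.
  have lin n := green_linear gG (ltn0Sn n) (ltn0Sn n).
  pose P n : {linear X -> X} := HB.pack (G n.-1.+1 n.-1.+1)
    (GRing.isLinear.Build K X X *:%R _ (lin n.-1)).
  by exists P; case.
have KerE n : (0 < n)%N -> Ker P n = [set x | G n n x = 0].
  by move=> n0; apply/seteqP; split=> x; rewrite /Ker/= PE.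
have invP : invariant_projections A P.
  move=> m m0; split=> [x|x|].
  - by rewrite !PE// green_proj.
  - by rewrite !PE// green_comm.
  - by rewrite !KerE//; exact: green_Ker_bij.
exists P => //; exists lam, (D + 1); split=> //; first by rewrite addr_gt0.
- move=> m n n0 nm; have m0 := leq_trans n0 nm.
  apply/opnorm_leP => //.
    by move=> a x y; rewrite linearP/= evol_linear.
  split=> [|x]; first by rewrite !mulr_ge0 ?powR_ge0 ?addr_ge0 ?ltW.
  rewrite PE// -green_evol ?leqnn ?orbT//.
  apply: le_trans (green_bound gG x m0 n0) _; rewrite decay_powR//.
  by rewrite !ler_wpM2r ?powR_ge0 ?rnorm_ge0// lerDl.
- move=> m n m0 mn; have n0 := leq_trans m0 mn.
  have backE x : evol_back A P m n (x - P n x) = x *+ (m == n) - G m n x.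
    move: mn; rewrite leq_eqVlt => /orP[/eqP mn|mn].
      rewrite -mn eqxx mulr1n -(PE _ _ m0) -[x - _ in LHS](evolxx A m).
      by rewrite (evol_backK invP)// (proj_compl_Ker invP).
    have -> : x - P n x = evol A n m (- G m n x).
      rewrite (linear_opp (evol_linear A n m)) green_evol_early//.
      by rewrite opprB PE.
    rewrite ltn_eqF// mulr0n sub0r (evol_backK invP) ?(ltnW mn)//.
    by rewrite linearN/= PE// green_proj_early// oppr0.
  apply/opnorm_leP => //.
    move=> a x y; rewrite !backE (green_linear gG m0 n0) mulrnDl scalerMnr.
    by rewrite scalerBr opprD addrACA.
  split=> [|x]; first by rewrite !mulr_ge0 ?powR_ge0 ?addr_ge0 ?ltW.
  rewrite backE -decay_powR// decayC.
  apply: le_trans (rnormD iota_real _ _) _; rewrite rnormN addrC !mulrDl lerD//.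
    exact: (green_bound gG).
  have [<-|_] := eqVneq m n; last first.
    by rewrite rnorm0// !mulr_ge0 ?decay_ge0 ?powR_ge0 ?rnorm_ge0.
  by rewrite mul1r decayxx mul1r ler_peMl ?rnorm_ge0 ?powR_nat_ge1.
Qed.

End green_dichotomy.
End green.

(** * Perturbation of a Green function *)

Section perturbation.
Variables (R : realType) (K : numFieldType) (iota : {rmorphism R -> K}).
Hypothesis iota_real : real_subfield iota.

Section approximation.
Variables (X : normedModType K) (A B : nat -> {linear X -> X}).
Variables (G : nat -> nat -> X -> X) (lam D eps c : R).
Local Notation N := (@rnorm R K iota X).
Hypotheses (gG : green iota A G lam D eps) (lam0 : 0 <= lam) (D0 : 0 <= D).
Hypotheses (c0 : 0 <= c) (c_small : D * c * expR lam <= 4^-1).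
Hypothesis BA : forall m x, (0 < m)%N ->
  N (A m x - B m x) <= c / m.+1%:R `^ (2 + eps) * N x.
Implicit Types (i j k m n p q : nat) (x y : X) (v : nat -> X).

Let Dc0 : 0 <= D * c. Proof. exact: mulr_ge0. Qed.

Let Dc_small : D * c <= 4^-1.
Proof. by apply: le_trans c_small; rewrite ler_peMr// -[leLHS]expR0 ler_expR. Qed.

(** The effect at time [m] of the perturbation acting at time [k] on [y]. *)
Definition kick m k y : X := G m k.+1 (B k y - A k y).

Lemma kick_linear m k : (0 < m)%N -> linear (kick m k).
Proof.
move=> m0 a x y; rewrite /kick !linearP/= -(green_linear gG m0 (ltn0Sn k)).
by rewrite addrACA -scalerDr.
Qed.

Lemma kick_rec m k y : (0 < m)%N ->
  kick m.+1 k y = A m (kick m k y) + (B k y - A k y) *+ (m == k).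
Proof. by move=> m0; rewrite /kick (green_rec gG). Qed.

Lemma kick_bound m k y : (0 < m)%N -> (0 < k)%N ->
  N (kick m k y) <= D * c * decay lam m k.+1 * (k.+1%:R ^+ 2)^-1 * N y.
Proof.
move=> m0 k0; apply: le_trans (green_bound gG _ m0 (ltn0Sn k)) _.
rewrite rnormB.
apply: (@le_trans _ _ (D * decay lam m k.+1 * k.+1%:R `^ eps *
    (c / k.+1%:R `^ (2 + eps) * N y))).
  by rewrite ler_wpM2l ?BA// !mulr_ge0 ?decay_ge0 ?powR_ge0.
rewrite [leLHS](_ : _ = D * decay lam m k.+1 *
  (k.+1%:R `^ eps * (c / k.+1%:R `^ (2 + eps))) * N y); last by ring.
by rewrite powR_absorb le_eqVlt; apply/orP; left; apply/eqP; ring.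
Qed.

Lemma sum_kick_bound v m p q (S : R) : (0 < m)%N -> (q <= p)%N -> 0 <= S ->
  (forall k, (0 < k)%N -> N (v k) <= S) ->
  N (\sum_(q.+1 <= k < p.+1) kick m k (v k)) <= 4^-1 * (S / q.+1%:R).
Proof.
move=> m0 qp S0 vS; apply: le_trans (rnorm_sum iota_real _ _ _) _.
apply: (@le_trans _ _ (4^-1 * S * \sum_(q.+1 <= k < p.+1) (k.+1%:R ^+ 2)^-1)).
  rewrite mulr_sumr; apply: ler_sum_nat => k /andP[qk _].
  have k0 : (0 < k)%N by exact: leq_ltn_trans qk.
  apply: le_trans (kick_bound _ m0 k0) _.
  have w0 : 0 <= (k.+1%:R ^+ 2)^-1 :> R by rewrite invr_ge0 exprn_ge0.
  rewrite [leLHS](_ : _ = D * c * (decay lam m k.+1 * N (v k)) *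
    (k.+1%:R ^+ 2)^-1); last by ring.
  rewrite ler_wpM2r// ler_pM ?mulr_ge0 ?decay_ge0 ?rnorm_ge0//.
  by apply: le_trans (vS _ k0); rewrite ler_piMl ?rnorm_ge0 ?decay_le1.
rewrite -mulrA ler_wpM2l// ler_wpM2l//.
by apply: le_trans (sum_inv_sqr _ qp) _; rewrite gerBl invr_ge0.
Qed.

Lemma sum_kick_decay v m n p (S : R) : (0 < m)%N -> 0 <= S ->
  (forall k, (0 < k)%N -> N (v k) <= S * decay lam k n) ->
  N (\sum_(1 <= k < p.+1) kick m k (v k)) <= 4^-1 * (S * decay lam m n).
Proof.
move=> m0 S0 vS; apply: le_trans (rnorm_sum iota_real _ _ _) _.
apply: (@le_trans _ _ (4^-1 * (S * decay lam m n) *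
    \sum_(1 <= k < p.+1) (k.+1%:R ^+ 2)^-1)); last first.
  by rewrite ler_piMr ?sum_inv_sqr_le1// !mulr_ge0 ?decay_ge0.
rewrite mulr_sumr; apply: ler_sum_nat => k /andP[k0 _].
apply: le_trans (kick_bound _ m0 k0) _.
have w0 : 0 <= (k.+1%:R ^+ 2)^-1 :> R by rewrite invr_ge0 exprn_ge0.
rewrite mulrAC ler_wpM2r//.
apply: (@le_trans _ _ (D * c * S * (decay lam m k.+1 * decay lam k n))).
  rewrite -!mulrA ler_wpM2l// ler_wpM2l// mulrCA ler_wpM2l ?decay_ge0//.
  exact: vS.
apply: (@le_trans _ _ (D * c * S * (expR lam * decay lam m n))).
  by rewrite ler_wpM2l ?mulr_ge0// decay_mulS.
rewrite [leLHS](_ : _ = D * c * expR lam * (S * decay lam m n)); last by ring.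
by rewrite ler_wpM2r// mulr_ge0 ?decay_ge0.
Qed.

(** The Green function [H] of [B] solves [H = G + sum_k kick m k (H k n)], a
    contraction. Truncating the [j]-th sum of the Picard iteration at [k < j]
    keeps it finite, and still lets the iterates converge since the tail of the
    sum tends to [0]. *)
Fixpoint approx j m n x : X :=
  if j is i.+1 then G m n x + \sum_(1 <= k < j) kick m k (approx i k n x) else 0.

Lemma approx_linear j m n : (0 < m)%N -> (0 < n)%N -> linear (approx j m n).
Proof.
move=> m0 n0; elim: j m m0 => [|j IH] m m0 a x y.
  by rewrite /= scaler0 addr0.
rewrite [LHS]/= (green_linear gG m0 n0) /= scalerDr scaler_sumr addrACA.
rewrite -big_split/=; congr (_ + _); apply: eq_big_nat => k /andP[k0 _].
by rewrite IH// kick_linear.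
Qed.

Lemma approx_bound j m n x : (0 < m)%N -> (0 < n)%N ->
  N (approx j m n x) <= 2 * D * decay lam m n * n%:R `^ eps * N x.
Proof.
move=> m0 n0; elim: j m m0 => [|j IH] m m0.
  by rewrite rnorm0// !mulr_ge0 ?decay_ge0 ?powR_ge0 ?rnorm_ge0.
apply: le_trans (rnormD iota_real _ _) _.
have S0 : 0 <= 2 * D * n%:R `^ eps * N x.
  by rewrite !mulr_ge0 ?powR_ge0 ?rnorm_ge0.
have /(sum_kick_decay j m0 S0) : forall k, (0 < k)%N ->
    N (approx j k n x) <= 2 * D * n%:R `^ eps * N x * decay lam k n.
  move=> k k0; apply: le_trans (IH _ k0) _.
  by rewrite le_eqVlt; apply/orP; left; apply/eqP; ring.
have := green_bound gG x m0 n0.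
have : 0 <= D * n%:R `^ eps * N x * decay lam m n.
  by rewrite !mulr_ge0 ?powR_ge0 ?rnorm_ge0 ?decay_ge0.
lra.
Qed.

Lemma approx_bound_unif j m n x : (0 < m)%N -> (0 < n)%N ->
  N (approx j m n x) <= 2 * D * n%:R `^ eps * N x.
Proof.
move=> m0 n0; apply: le_trans (approx_bound _ _ m0 n0) _.
rewrite ler_wpM2r ?rnorm_ge0// ler_wpM2r ?powR_ge0//.
by rewrite ler_piMr ?mulr_ge0// decay_le1.
Qed.

(** The two iterates differ by a contracted difference of earlier iterates, and
    by the part of the sum beyond the shorter truncation, itself of size [1 / (q + 1)]. *)
Lemma approx_cauchy p q m n x : (0 < m)%N -> (0 < n)%N -> (q <= p)%N ->
  N (approx p m n x - approx q m n x) <= 2 * D * n%:R `^ eps * N x / q.+1%:R.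
Proof.
move=> m0 n0; set C := 2 * D * _ * _.
have C0 : 0 <= C by rewrite !mulr_ge0 ?powR_ge0 ?rnorm_ge0.
elim: q p m m0 => [p|q IH [//|p]] m m0 qp.
  by rewrite subr0 divr1; exact: approx_bound_unif.
have -> : approx p.+1 m n x - approx q.+1 m n x =
    \sum_(1 <= k < q.+1) kick m k (approx p k n x - approx q k n x) +
    \sum_(q.+1 <= k < p.+1) kick m k (approx p k n x).
  rewrite /= (big_cat_nat (n := q.+1))//= opprD addrACA subrr add0r.
  rewrite addrAC -sumrB; congr (_ + _); apply: eq_bigr => k _.
  by rewrite linear_sub//; exact: kick_linear.
apply: le_trans (rnormD iota_real _ _) _.
pose S := C / q.+1%:R; have S0 : 0 <= S by rewrite divr_ge0.
have h1 := @sum_kick_bound (fun k => approx p k n x - approx q k n x) m q 0 S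
  m0 (leq0n q) S0 (fun k (k0 : (0 < k)%N) => IH p k k0 qp).
have h2 := @sum_kick_bound (fun k => approx p k n x) m p q C m0 qp C0
  (fun k (k0 : (0 < k)%N) => @approx_bound_unif p k n x k0 n0).
apply: le_trans (lerD h1 h2) _; rewrite divr1 -/S -mulrDl.
apply: le_trans (half_rate q C0); rewrite ler_wpM2r//; lra.
Qed.

Lemma approx_rec j m n x : (0 < m)%N -> (0 < n)%N -> (m <= j)%N ->
  approx j.+1 m.+1 n x =
  A m (approx j.+1 m n x) + (B m (approx j m n x) - A m (approx j m n x)) +
  x *+ (m.+1 == n).
Proof.
move=> m0 n0 mj; rewrite /= (green_rec gG)// linearD linear_sum/=.
rewrite addrAC; congr (_ + _); rewrite -addrA; congr (_ + _).
under eq_bigr do rewrite kick_rec//.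
rewrite big_split/=; congr (_ + _).
rewrite (bigD1_seq m) ?mem_index_iota ?m0 ?iota_uniq//= eqxx mulr1n.
by rewrite big1 ?addr0// => k km; rewrite eq_sym (negbTE km).
Qed.

Lemma approx_corec j m n x : (0 < m)%N -> (0 < n)%N -> (n <= j)%N ->
  approx j.+1 m n x - approx j.+1 m n.+1 (B n x) - x *+ (m == n) =
  \sum_(1 <= k < j.+1) kick m k
    (approx j k n x - approx j k n.+1 (B n x) - x *+ (k == n)).
Proof.
move=> m0 n0 nj.
have lin k := linear_sub (kick_linear k m0).
under [RHS]eq_bigr do rewrite !lin.
have kickn : \sum_(1 <= k < j.+1) kick m k (x *+ (k == n)) = kick m n x.
  rewrite (bigD1_seq n) ?mem_index_iota ?n0 ?iota_uniq//= eqxx mulr1n.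
  rewrite big1 ?addr0// => k /negbTE->.
  exact/linear_zero/kick_linear.
rewrite !sumrB kickn /= (green_corec gG x m0 n0).
rewrite [kick m n x](linear_sub (green_linear gG m0 (ltn0Sn n))).
set GA := G m n.+1 (A n x); set GB := G m n.+1 (B n x).
set S1 := bigop.body _ _ _; set S2 := bigop.body _ _ _; set d := x *+ _.
rewrite [GA + d + S1]addrAC [GA + S1 + d - _]addrAC addrK.
by rewrite [in LHS]opprD addrACA opprB [RHS]addrC.
Qed.

(** The defect of the second identity satisfies the homogeneous equation, hence
    shrinks at each step once the impulse time [n] is below the truncation. *)
Lemma approx_corec_bound n x : (0 < n)%N -> exists E : R, forall j m, (0 < m)%N ->
  N (approx j m n x - approx j m n.+1 (B n x) - x *+ (m == n)) <= E / j.+1%:R.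
Proof.
move=> n0.
pose S := 2 * D * n%:R `^ eps * N x + 2 * D * n.+1%:R `^ eps * N (B n x) + N x.
have S0 : 0 <= S by rewrite !addr_ge0 ?mulr_ge0 ?powR_ge0 ?rnorm_ge0.
have uS j m : (0 < m)%N ->
    N (approx j m n x - approx j m n.+1 (B n x) - x *+ (m == n)) <= S.
  move=> m0; apply: le_trans (rnormD iota_real _ _) _.
  rewrite rnormN; apply: lerD; last first.
    by case: eqP => _; rewrite ?rnorm0 ?rnorm_ge0.
  apply: le_trans (rnormD iota_real _ _) _.
  by rewrite rnormN; apply: lerD; exact: approx_bound_unif.
exists (S * n.+1%:R); elim=> [|j IH] m m0.
  by rewrite divr1 (le_trans (uS _ _ m0))// ler_peMr// ler1n.
have [jn|nj] := ltnP j n.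
  apply: le_trans (uS _ _ m0) _; rewrite ler_pdivlMr ?ltr0n//.
  by rewrite ler_wpM2l// ler_nat.
rewrite approx_corec//.
pose S' := S * n.+1%:R / j.+1%:R; have S'0 : 0 <= S' by rewrite divr_ge0 ?mulr_ge0.
have := @sum_kick_bound (fun k => approx j k n x - approx j k n.+1 (B n x) -
  x *+ (k == n)) m j 0 S' m0 (leq0n j) S'0 IH.
move=> /le_trans; apply; rewrite divr1.
have T0 : 0 <= S * n.+1%:R by rewrite mulr_ge0.
apply: le_trans (half_rate j T0); rewrite ler_wpM2r// lef_pV2 ?posrE ?ltr0n//.
by rewrite ler_nat.
Qed.

Lemma approx_ker j m x : (0 < m)%N -> G 1 1 x = 0 -> approx j m 1 x = 0.
Proof.
move=> m0 Gx; elim: j m m0 => [//|j IH] m m0 /=.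
rewrite (green_evol gG x (ltn0Sn 0) m0)// ?orbT// Gx (linear_zero (evol_linear A m 1)).
rewrite add0r.
apply: big1_seq => k /andP[_]; rewrite mem_index_iota => /andP[k0 _].
rewrite IH//; exact/linear_zero/kick_linear.
Qed.

(** The equation for [H] only adds to [G 1 n] terms that [G 1 1] kills, so the
    boundary conditions at time [1] hold exactly for the iterates. *)
Lemma approx_bdry j n x : (0 < n)%N ->
  G 1 1 (approx j.+1 1 n x) = G 1 1 (G 1 n x).
Proof.
move=> n0; have := green_linear gG (ltn0Sn 0) (ltn0Sn 0) => lin11.
pose g : {linear X -> X} :=
  HB.pack (G 1 1) (GRing.isLinear.Build K X X *:%R _ lin11).
rewrite -[LHS]/(g _) -[RHS]/(g _) linearD linear_sum/= big1_seq ?addr0//.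
move=> k /andP[_]; rewrite mem_index_iota => /andP[k0 _].
by rewrite [LHS](green_bdry gG).
Qed.

End approximation.

Section limit.
Variables (X : completeNormedModType K) (A B : nat -> {linear X -> X}).
Variables (G : nat -> nat -> X -> X) (lam D eps c : R).
Local Notation N := (@rnorm R K iota X).
Hypotheses (gG : green iota A G lam D eps) (lam0 : 0 <= lam) (D0 : 0 <= D).
Hypotheses (c0 : 0 <= c) (c_small : D * c * expR lam <= 4^-1).
Hypothesis BA : forall m x, (0 < m)%N ->
  N (A m x - B m x) <= c / m.+1%:R `^ (2 + eps) * N x.
Hypothesis A_bounded : forall m, (0 < m)%N ->
  exists M : R, forall x, N (A m x) <= M * N x.
Implicit Types (j m n : nat) (x : X).

Local Notation approx := (approx A B G).
Local Notation tends := (@tends R K iota X).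

Definition perturbed_green m n x : X :=
  xget 0 [set l | tends (fun j => approx j m n x) l].
Local Notation H := perturbed_green.

Lemma approx_tends m n x : (0 < m)%N -> (0 < n)%N ->
  tends (fun j => approx j m n x) (H m n x).
Proof.
move=> m0 n0.
have [l lP] : exists l, tends (fun j => approx j m n x) l.
  apply: (@tends_cauchy _ _ _ iota_real X _ (2 * D * n%:R `^ eps * N x)) => p q qp.
  exact: (approx_cauchy gG lam0 D0 c0 c_small BA).
by rewrite /perturbed_green; case: xgetP => [y _ //|/(_ l)].
Qed.

Lemma perturbed_green_ker x : G 1 1 x = 0 -> H 1 1 x = 0.
Proof.
move=> Gx; apply: tends_unique (approx_tends x (ltn0Sn 0) (ltn0Sn 0)) _ => //.
under eq_fun do rewrite (approx_ker B gG)//.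
exact: tends_cst.
Qed.

Lemma perturbed_green_bdry n x : (0 < n)%N -> G 1 1 (H 1 n x) = G 1 1 (G 1 n x).
Proof.
move=> n0; have lin11 := green_linear gG (ltn0Sn 0) (ltn0Sn 0).
have b11 y := green_bound gG y (ltn0Sn 0) (ltn0Sn 0).
have GH := tends_linear iota_real lin11 b11 (approx_tends x (ltn0Sn 0) n0).
apply: tends_unique (tendsS GH) _ => //.
under eq_fun do rewrite (approx_bdry B gG)//.
exact: tends_cst.
Qed.

Lemma perturbed_green_linear m n : (0 < m)%N -> (0 < n)%N -> linear (H m n).
Proof.
move=> m0 n0 a x y.
apply: tends_unique (approx_tends _ m0 n0) _ => //.
under eq_fun do rewrite (approx_linear B gG)//.
apply: tendsD => //; first apply: tendsZ => //; exact: approx_tends.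
Qed.

Lemma perturbed_green_rec m n x : (0 < m)%N -> (0 < n)%N ->
  H m.+1 n x = B m (H m n x) + x *+ (m.+1 == n).
Proof.
move=> m0 n0; have [M AM] := A_bounded m0.
have linA : linear (A m) by move=> a u v; rewrite linearP.
have linB : linear (B m) by move=> a u v; rewrite linearP.
have BM y : N (B m y) <= (M + c / m.+1%:R `^ (2 + eps)) * N y.
  rewrite -(subKr (A m y) (B m y)) mulrDl; apply: le_trans (rnormD iota_real _ _) _.
  by rewrite rnormN lerD// BA.
have AH := tends_linear iota_real linA AM (approx_tends x m0 n0).
have BH := tends_linear iota_real linB BM (approx_tends x m0 n0).
apply: tends_unique (tendsS (approx_tends x (ltn0Sn m) n0)) _ => //.
apply: (@tends_eventually _ _ _ iota_real _ (fun j => A m (approx j.+1 m n x) +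
  (B m (approx j m n x) - A m (approx j m n x)) + x *+ (m.+1 == n)) _ _ m).
  rewrite -[B m (H m n x)](addrNK (A m (H m n x))) [_ - _ + _]addrC.
  apply: tendsD => //; last exact: tends_cst.
  by apply: tendsD => //; [exact: tendsS AH|exact: tendsB].
by move=> j mj; rewrite (approx_rec B gG).
Qed.

Lemma perturbed_green_corec m n x : (0 < m)%N -> (0 < n)%N ->
  H m n x = H m n.+1 (B n x) + x *+ (m == n).
Proof.
move=> m0 n0; have [E EP] := approx_corec_bound gG lam0 D0 c0 c_small BA x n0.
apply/eqP; rewrite -subr_eq0 opprD addrA; apply/eqP.
have HD := tendsB iota_real (tendsB iota_real (approx_tends x m0 n0)
  (approx_tends (B n x) m0 (ltn0Sn n))) (tends_cst iota_real (x *+ (m == n))).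
apply: tends_unique HD _ => //.
by exists E => j; rewrite subr0 EP.
Qed.

Lemma perturbed_green_green : green iota B H lam (2 * D) eps.
Proof.
have lin11 := linear_sub (green_linear gG (ltn0Sn 0) (ltn0Sn 0)).
split.
- exact: perturbed_green_linear.
- exact: perturbed_green_rec.
- exact: perturbed_green_corec.
- move=> x; apply/eqP; rewrite -subr_eq0.
  rewrite -(linear_sub (perturbed_green_linear (ltn0Sn 0) (ltn0Sn 0))).
  apply/eqP/perturbed_green_ker; rewrite lin11 perturbed_green_bdry//.
  by rewrite (green_proj1 gG) subrr.
- move=> n x n1; apply: perturbed_green_ker.
  by rewrite perturbed_green_bdry ?(ltnW n1)// (green_bdry gG).
- move=> m n x m0 n0; apply: tends_rnorm_le (approx_tends x m0 n0) _ => // j.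
  exact: (approx_bound gG lam0 D0 c0 c_small BA).
Qed.

End limit.
End perturbation.

(** * Polynomial growth *)

Section growth.
Variables (R : realType) (K : numFieldType) (iota : {rmorphism R -> K}).
Hypothesis iota_real : real_subfield iota.
Variables (X : normedModType K) (A B : nat -> {linear X -> X}).
Variables (L b eps c : R).
Local Notation N := (@rnorm R K iota X).
Hypotheses (L0 : 0 <= L) (b0 : 0 <= b) (c0 : 0 <= c) (c_small : L * c <= 4^-1).
Hypothesis BA : forall m x, (0 < m)%N ->
  N (A m x - B m x) <= c / m.+1%:R `^ (2 + eps) * N x.
Hypothesis A_growth : forall m n x, (0 < n)%N -> (n <= m)%N ->
  N (evol A m n x) <= L * (m%:R / n%:R) `^ b * n%:R `^ eps * N x.
Implicit Types (k m n : nat) (x : X).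

Lemma evol_variation m n x : (n <= m)%N ->
  evol B m n x = evol A m n x +
    \sum_(n <= k < m) evol A m k.+1 (B k (evol B k n x) - A k (evol B k n x)).
Proof.
elim: m => [|m IH].
  by rewrite leqn0 => /eqP->; rewrite !evolxx big_geq// addr0.
rewrite leq_eqVlt => /orP[/eqP->|nm]; first by rewrite !evolxx big_geq// addr0.
rewrite big_nat_recr// evolxx !evolS//.
rewrite [X in _ = _ + (X + _)](_ : _ = A m (evol B m n x - evol A m n x)).
  by rewrite linearB/= addrA !subrKC.
rewrite IH// addrAC subrr add0r linear_sum/=.
by apply: eq_big_nat => k /andP[_ km]; rewrite evolS.
Qed.

Lemma growth_mul m k n : (0 < n)%N -> (n <= k)%N -> (k < m)%N ->
  (m%:R / k.+1%:R) `^ b * (k%:R / n%:R) `^ b <= (m%:R / n%:R) `^ b :> R.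
Proof.
move=> n0 nk km; have k0 := leq_trans n0 nk; have m0 := leq_ltn_trans k0 km.
have m0' : (0 < m)%N by exact: leq_trans km.
rewrite !powR_div_nat// -expRD ler_expR -mulrDr ler_wpM2l//.
by have := @ln_nat_le R _ _ k0 (leqnSn k); lra.
Qed.

(** The discrete Gronwall inequality for [evol_variation]. As the kernel sums to
    at most [1/4], the constant only doubles and the exponents are unchanged. *)
Lemma evol_growth m n x : (0 < n)%N -> (n <= m)%N ->
  N (evol B m n x) <= 2 * L * (m%:R / n%:R) `^ b * n%:R `^ eps * N x.
Proof.
move=> n0; elim/ltn_ind: m => m IH nm; rewrite evol_variation//.
set T := L * (m%:R / n%:R) `^ b * n%:R `^ eps * N x.
have T0 : 0 <= T by rewrite !mulr_ge0 ?powR_ge0 ?rnorm_ge0.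
apply: (@le_trans _ _ (T + 2^-1 * T)); last by rewrite /T in T0 *; lra.
apply: le_trans (rnormD iota_real _ _) _; rewrite lerD ?A_growth//.
apply: le_trans (rnorm_sum iota_real _ _ _) _.
apply: (@le_trans _ _ (2^-1 * T * \sum_(n <= k < m) (k.+1%:R ^+ 2)^-1)); last first.
  by rewrite ler_piMr ?sum_inv_sqr_le1// mulr_ge0.
rewrite mulr_sumr; apply: ler_sum_nat => k /andP[nk km].
apply: le_trans (A_growth _ (ltn0Sn k) km) _; rewrite rnormB.
have k0 := leq_trans n0 nk.
have e0 : 0 <= k.+1%:R `^ eps by exact: powR_ge0.
have w0 : 0 <= (k.+1%:R ^+ 2)^-1 :> R by rewrite invr_ge0 exprn_ge0.
have h := le_trans (BA (evol B k n x) k0) (ler_wpM2l _ (IH k km nk)).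
apply: le_trans (ler_wpM2l _ (h _)) _.
- by rewrite !mulr_ge0 ?powR_ge0.
- by rewrite divr_ge0 ?powR_ge0.
rewrite [leLHS](_ : _ = L * (k.+1%:R `^ eps * (c / k.+1%:R `^ (2 + eps))) *
  ((m%:R / k.+1%:R) `^ b * (k%:R / n%:R) `^ b) * (2 * L * n%:R `^ eps * N x));
  last by ring.
rewrite powR_absorb.
apply: (@le_trans _ _ (L * (c / k.+1%:R ^+ 2) * (m%:R / n%:R) `^ b *
  (2 * L * n%:R `^ eps * N x))).
  rewrite ler_wpM2r ?mulr_ge0 ?powR_ge0 ?rnorm_ge0// ler_wpM2l ?growth_mul//.
  by rewrite !mulr_ge0.
rewrite [leLHS](_ : _ = L * c * (2 * T) * (k.+1%:R ^+ 2)^-1); last first.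
  by rewrite /T; ring.
rewrite ler_wpM2r//.
have := ler_wpM2r T0 c_small; lra.
Qed.

End growth.

(** * Robustness of strong polynomial dichotomies *)

Unset Implicit Arguments.
Set Strict Implicit.

Theorem theorem8 (R : realType) (K : numFieldType) (iota : {rmorphism R -> K})
    (iota_real : real_subfield iota) (X : completeNormedModType K)
    (A : nat -> {linear X -> X})
    (A_bounded : forall m, (0 < m)%N -> bounded_near (A m) (nbhs (0 : X)))
    (eps : R) (A_dich : strong_npdichotomy iota eps A) :
  exists2 c0 : R, 0 < c0 &
    forall c : R, 0 < c -> c <= c0 ->
    forall B : nat -> {linear X -> X},
      (forall m, (0 < m)%N -> bounded_near (B m) (nbhs (0 : X))) ->
      (forall m, (0 < m)%N ->
         (opnorm iota (fun x => (A m x - B m x)%R) <=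
          (c / (m.+1)%:R `^ (2 + eps))%:E)%E) ->
      exists eps' : R, strong_npdichotomy iota eps' B.
Proof.
have [[P invP [lam [D [lam0 D0 eps0 fwd bwd]]]] [L [b [L0 b0 growA]]]] := A_dich.
have A_growth m n x : (0 < n)%N -> (n <= m)%N -> rnorm iota (evol A m n x) <=
    L * (m%:R / n%:R) `^ b * n%:R `^ eps * rnorm iota x.
  move=> n0 nm.
  by have /(opnorm_leP iota_real _ (evol_linear A m n))[_] := growA m n n0 nm.
(* [D * expR lam] makes the equation for the Green function contract, [L] makes
   the Gronwall kernel small. *)
pose s := D * expR lam + L.
have s0 : 0 < s by rewrite addr_gt0 ?mulr_gt0 ?expR_gt0.
exists (4 * s)^-1; first by rewrite invr_gt0 mulr_gt0.
move=> c c0 cs B _ opBA.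
have BA m x : (0 < m)%N -> rnorm iota (A m x - B m x) <=
    c / m.+1%:R `^ (2 + eps) * rnorm iota x.
  move=> m0.
  have lin : linear (fun x => A m x - B m x).
    by move=> a u v; rewrite !linearP/= addrACA -scalerDr.
  by have /(opnorm_leP iota_real _ lin)[_] := opBA m m0.
have sc : c * s <= 4^-1.
  apply: le_trans (ler_wpM2r (ltW s0) cs) _.
  by rewrite invfM -mulrA mulVf ?gt_eqF// mulr1.
have small : D * c * expR lam <= 4^-1.
  by apply: le_trans sc; rewrite /s; have := mulr_gt0 c0 L0; lra.
have Lsmall : L * c <= 4^-1.
  apply: le_trans sc; rewrite /s.
  by have := mulr_gt0 c0 (mulr_gt0 D0 (expR_gt0 lam)); lra.
have gA := dich_green_green iota_real invP fwd bwd.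
have A_bnd m : (0 < m)%N ->
    exists M : R, forall x, rnorm iota (A m x) <= M * rnorm iota x.
  move=> m0; exists (L * (m.+1%:R / m%:R) `^ b * m%:R `^ eps) => x.
  by have := A_growth m.+1 m x m0 (leqnSn m); rewrite evolS// evolxx.
have gB := perturbed_green_green iota_real gA (ltW lam0) (ltW D0) (ltW c0) small
  BA A_bnd.
exists eps; split.
  by apply: (green_npdichotomy iota_real gB) => //; rewrite mulr_gt0.
exists (2 * L), b; split=> // [|m n n0 nm]; first by rewrite mulr_gt0.
apply/(opnorm_leP iota_real _ (evol_linear B m n)); split=> [|x].
  by rewrite !mulr_ge0 ?powR_ge0 ?ltW.
exact: (evol_growth iota_real (ltW L0) (ltW b0) (ltW c0) Lsmall BA A_growth).
Qed.
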